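(* Let $A\subset\mathbb{R}$ be non-empty and closed, let $t>0$, and let $N_t\in\mathbb{N}\cup\{\infty\}$ denote the number of connected components of the open enlargement $A^t=\{x\in\mathbb{R}: d_A(x)<t\}$. Then $$N_t-1\le\mathcal{H}^0\bigl(\{x\in\mathbb{R}: d_A(x)=t\}\bigr)\le 2N_t,$$ with the convention that both the left-hand and right-hand sides are infinite when $N_t=\infty$.
   Context: Here $d_A(x):=\inf_{y\in A}|x-y|$ is the distance function to $A$, and $\mathcal{H}^0$ is the $0$-dimensional Hausdorff measure, i.e. the counting measure (number of elements, possibly $\infty$). *)

(* Defs.v *)
From HB Require Import structures.
From mathcomp Require Import all_boot all_order all_algebra.
From mathcomp Require Import all_classical all_reals all_analysis.

Set Implicit Arguments.
Unset Strict Implicit.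
Unset Printing Implicit Defensive.

Import Order.TTheory GRing.Theory Num.Theory.
Import numFieldNormedType.Exports.

Local Open Scope classical_set_scope.
Local Open Scope ring_scope.

(* [inf] is the usual infimum only when A is nonempty, the set of distances
   being always bounded below by 0; it is 0 when A is empty. *)
Definition dist_to (R : realType) (A : set R) (x : R) : R :=
  inf [set `|x - y| | y in A].

Definition enlargement (R : realType) (A : set R) (t : R) : set R :=
  [set x | dist_to A x < t].

Definition level_set (R : realType) (A : set R) (t : R) : set R :=
  [set x | dist_to A x = t].

Definition components (T : topologicalType) (E : set T) : set (set T) :=
  [set connected_component E x | x in E].

(* [counting], with values in \bar R, is the number of elements of a set, and
   +oo when the set is infinite. *)
Definition num_components (R : realType) (T : topologicalType) (E : set T) :
  \bar R := counting (components E).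

(* The 0-dimensional Hausdorff measure is the counting measure. *)
Definition hausdorff0 (R : realType) (X : set R) : \bar R := counting X.

(* Main.v *)
Require Import Defs.
From HB Require Import structures.
From mathcomp Require Import all_boot all_order all_algebra.
From mathcomp Require Import all_classical all_reals all_analysis.
From mathcomp Require Import finmap lra.

Set Implicit Arguments.
Unset Strict Implicit.
Unset Printing Implicit Defensive.

Import Order.TTheory GRing.Theory Num.Theory.
Import numFieldNormedType.Exports.

Local Open Scope classical_set_scope.
Local Open Scope ring_scope.

(** The set E of points at distance less than t from A is a union of balls
    centred on A, hence open, and its components are open intervals.  Both
    inequalities compare the points at distance t with the endpoints of these
    intervals.

    Lower bound.  The supremum of a component C that is bounded above does not
    belong to E, because E is open and C is maximal ([sup_component_notin]);
    being a limit of points of E, it lies at distance exactly t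
    ([sup_component_level]).  Two components with the same supremum meet, hence
    coincide ([sup_component_inj]), so there are at least as many points at
    distance t as components bounded above.  Only one component can be
    unbounded above ([unbounded_component_unique]), which accounts for the -1.

    Upper bound.  Let x be at distance t from A.  As A is closed, x - t or x + t
    is in A ([dist_to_attained]).  The points strictly between x and this
    nearest point of A are at distance less than t, so that x is the supremum or
    the infimum of the component of the nearest point ([level_setU]).  The
    points at distance t are thus covered by the image of the set of components
    under [sup] and its image under [inf], which accounts for the factor 2.

    Both comparisons are inequalities between cardinals ([counting_card_le]), so
    that they cover finite and infinite numbers of components alike. *)

(** * The counting measure and cardinal comparison *)

Lemma counting_card_le (R : realType) (T U : choiceType)
    (X : set T) (Y : set U) :
  (X #<= Y)%card -> (counting X <= counting Y :> \bar R)%E.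
Proof.
move=> XY; rewrite /counting; case: asboolP => [Xfin|Xinf]; last first.
  by rewrite asboolF // => /(card_le_finite XY).
case: asboolP => [/finite_setP[n Yn]|_]; last exact: leey.
rewrite lee_fin ler_nat (card_fset_set Yn).
by apply: geq_card_fset_set; rewrite -(card_le_eqr Yn).
Qed.

Lemma counting_set1 (R : realType) (T : choiceType) (x : T) :
  counting [set x] = 1%E :> \bar R.
Proof. by rewrite /counting asboolT ?fset_set1 ?cardfs1. Qed.

Lemma counting_setU (R : realType) (T : choiceType) (X Y : set T) :
  (counting (X `|` Y) <= counting X + counting Y :> \bar R)%E.
Proof.
have [Xfin|Xinf] := pselect (finite_set X); last first.
  by rewrite [in leRHS]/counting (asboolF Xinf); case: ifP => _; rewrite leey.
have [Yfin|Yinf] := pselect (finite_set Y); last first.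
  by rewrite [in leRHS]/counting (asboolF Yinf); case: ifP => _; rewrite leey.
rewrite /counting !asboolT ?finite_setU// fset_setU//.
by rewrite -EFinD lee_fin -natrD ler_nat leq_card_fsetU.
Qed.

(** * The distance to a set *)

Section DistanceToSet.
Variables (R : realType) (A : set R).
Implicit Types (t x y : R).

Lemma dist_to_le x y : A y -> dist_to A x <= `|x - y|.
Proof.
move=> Ay; apply: ge_inf; last by exists y.
by exists 0 => _ [z _ <-].
Qed.

Lemma dist_to_ltP t x : A !=set0 ->
  dist_to A x < t <-> exists2 y, A y & `|x - y| < t.
Proof.
move=> [a Aa]; split=> [|[y Ay]]; last exact/le_lt_trans/dist_to_le.
by case/inf_lt => [|_ [y Ay <-]]; [exists `|x - a|, a|exists y].
Qed.

Lemma enlargement_bigcup t : A !=set0 ->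
  enlargement A t = \bigcup_(y in A) ball y t.
Proof.
move=> A0; apply/seteqP; split=> x.
  by move=> /(dist_to_ltP _ _ A0)[y Ay xy]; exists y; rewrite // /ball/= distrC.
move=> [y Ay]; rewrite /ball/= distrC => xy.
by apply/dist_to_ltP => //; exists y.
Qed.

Lemma open_enlargement t : A !=set0 -> open (enlargement A t).
Proof.
move=> A0; rewrite enlargement_bigcup//.
by apply: bigcup_open => y _; exact: ball_open.
Qed.

(** The open interval of radius [dist_to A x] around [x] misses [A].  If both of
    its endpoints were outside the closed set [A], a slightly larger interval
    would still miss [A], and the distance would be larger. *)
Lemma dist_to_attained x : A !=set0 -> closed A ->
  A (x - dist_to A x) \/ A (x + dist_to A x).
Proof.
set t := dist_to A x => A0 Acl; apply: contrapT => /not_orP[AxB AxD].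
have openC : open (~` A) by exact: closed_openC.
have := open_nbhs_nbhs (conj openC AxB); move=> /nbhs_ballP[e /= e0 eB].
have := open_nbhs_nbhs (conj openC AxD); move=> /nbhs_ballP[f /= f0 fB].
have : dist_to A x < t + Num.min e f by rewrite ltrDl lt_min e0.
move=> /(dist_to_ltP _ _ A0)[y Ay]; rewrite -ltrBlDl lt_min => /andP[ye yf].
have ty := dist_to_le x Ay; rewrite -/t in ty.
have [yx|xy] := leP y x.
  have xyE : `|x - y| = x - y by rewrite ger0_norm ?subr_ge0.
  apply: (eB y) => //; rewrite /ball/= ger0_norm; lra.
have xyE : `|x - y| = y - x by rewrite distrC gtr0_norm ?subr_gt0.
by apply: (fB y) => //; rewrite /ball/= distrC ger0_norm; lra.
Qed.

End DistanceToSet.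

(** * Components of a subset of the line *)

Section Components.
Variables (R : realType) (E : set R).
Implicit Types (a x : R) (C D : set R).

Lemma component_is_interval C : components E C -> is_interval C.
Proof. by case=> x _ <-; apply/connected_intervalP/component_connected. Qed.

Lemma component_sub C : components E C -> C `<=` E.
Proof. by case=> x _ <-; exact: connected_component_sub. Qed.

Lemma component_nonempty C : components E C -> C !=set0.
Proof. by case=> x Ex <-; exists x; exact: connected_component_refl. Qed.

(** The maximality of components, stated for a set [C] known to be a component
    without reference to the point that it was built from. *)
Lemma interval_sub_component C D x : components E C ->
  is_interval D -> D `<=` E -> C x -> D x -> D `<=` C.
Proof.
move=> [y _ <-] /connected_intervalP Dco DE yx Dx.
by rewrite (same_connected_component yx); exact: connected_component_max.
Qed.

Lemma component_meet C D x : components E C -> components E D ->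
  C x -> D x -> C = D.
Proof.
move=> CE DE Cx Dx; apply/seteqP; split.
  apply: (interval_sub_component DE _ _ Dx Cx).
    exact: component_is_interval.
  exact: component_sub.
apply: (interval_sub_component CE _ _ Cx Dx).
  exact: component_is_interval.
exact: component_sub.
Qed.

(** If [x] in [C] lies to the left of [y] in [D], some [z] in [C] lies to the
    right of [y], and then [y] belongs to the interval [C].  This single
    criterion covers two components with the same supremum as well as two
    components unbounded above. *)
Lemma component_cofinal C D : components E C -> components E D ->
  (forall x, C x -> exists2 y, D y & x < y) ->
  (forall x, D x -> exists2 y, C y & x < y) -> C = D.
Proof.
move=> CE DE CD DC.
have [x Cx] := component_nonempty CE; have [y Dy] := component_nonempty DE.
have [xy|/ltW yx] := leP x y.
  have [z Cz yz] := DC y Dy; apply: (component_meet CE DE _ Dy).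
  by apply: (component_is_interval CE Cx Cz); rewrite xy ltW.
have [z Dz xz] := CD x Cx; apply: (component_meet CE DE Cx _).
by apply: (component_is_interval DE Dy Dz); rewrite yx ltW.
Qed.

Lemma unbounded_component_unique C D : components E C -> components E D ->
  ~ has_ubound C -> ~ has_ubound D -> C = D.
Proof.
have gtx F x : ~ has_ubound F -> exists2 y, F y & x < y.
  move=> Fx; apply: contrapT => nF; apply: Fx; exists x => y Fy.
  by rewrite leNgt; apply/negP => xy; apply: nF; exists y.
by move=> CE DE Cub Dub; apply: component_cofinal => // x _; exact: gtx.
Qed.

(** If [sup C] were in the open set [E], adding to [C] a small interval around
    [sup C] would produce a larger interval inside [E]. *)
Lemma sup_component_notin C : open E -> components E C -> has_ubound C ->
  ~ E (sup C).
Proof.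
move=> Eo CE Cub Es; have Csup : has_sup C.
  by split=> //; exact: component_nonempty.
have /nbhs_ballP[e /= e0 eE] := open_nbhs_nbhs (conj Eo Es).
have [y Cy sy] := sup_adherent e0 Csup.
have ys : y <= sup C := sup_upper_bound Csup Cy.
suff Cz : C (sup C + e / 2).
  have := sup_upper_bound Csup Cz; rewrite leNgt => /negP; apply; lra.
apply: (@interval_sub_component C `[y, sup C + e / 2] y CE) => //=.
- exact: interval_is_interval.
- move=> z /=; rewrite in_itv/= => /andP[yz zs]; apply: eE.
  by rewrite /ball/= ltr_norml; apply/andP; split; lra.
- by rewrite in_itv/= lexx/=; lra.
- by rewrite in_itv/= lexx andbT; lra.
Qed.

(** As its supremum is not attained, each of two components with the same
    supremum has points beyond any point of the other one. *)
Lemma sup_component_inj : open E ->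
  {in [set C | components E C /\ has_ubound C] &, injective sup}.
Proof.
move=> Eo C D /set_mem[CE Cub] /set_mem[DE Dub] CD.
have lt_sup F x : components E F -> has_ubound F -> F x -> x < sup F.
  move=> FE Fub Fx; rewrite lt_neqAle (ub_le_sup Fub Fx) andbT; apply/eqP => xF.
  apply: (sup_component_notin Eo FE Fub); rewrite -xF.
  exact: component_sub Fx.
by apply: component_cofinal => // x Fx; apply: sup_gt;
  do ?[exact: component_nonempty]; [rewrite -CD|rewrite CD]; exact: lt_sup.
Qed.

(** The component contains [`[a, x[] and, being an interval that avoids [x],
    does not extend beyond [x]. *)
Lemma sup_componentE a x : a < x -> `[a, x[ `<=` E -> ~ E x ->
  sup (connected_component E a) = x.
Proof.
move=> ax axE Ex; set C := connected_component E a.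
have aa : `[a, x[%classic a by rewrite /= in_itv/= lexx.
have CE : components E C by exists a => //; exact: axE.
have Ca : C a by exact/connected_component_refl/axE.
have axC : `[a, x[ `<=` C.
  apply: (interval_sub_component CE _ axE Ca aa).
  exact: interval_is_interval.
have Cx : ubound C x.
  move=> y Cy; rewrite leNgt; apply/negP => xy; apply: Ex.
  by apply: (component_sub CE); apply: (component_is_interval CE Ca Cy);
    rewrite !ltW.
apply/eqP; rewrite eq_le ge_sup//=; last by exists a.
rewrite leNgt; apply/negP => sx.
(* The midpoint of [sup C] and [x] is in [`[a, x[], hence in [C]. *)
have le_as : a <= sup C by apply: ub_le_sup => //; exists x.
have /ub_le_sup -/(_ ((sup C + x) / 2)) : has_ubound C by exists x.
move=> /(_ (axC _ _)); rewrite /= in_itv/= => H.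
suff : (sup C + x) / 2 <= sup C by lra.
by apply: H; apply/andP; split; lra.
Qed.

Lemma inf_componentE a x : x < a -> `]x, a] `<=` E -> ~ E x ->
  inf (connected_component E a) = x.
Proof.
move=> xa xaE Ex; set C := connected_component E a.
have aa : `]x, a]%classic a by rewrite /= in_itv/= lexx andbT.
have CE : components E C by exists a => //; exact: xaE.
have Ca : C a by exact/connected_component_refl/xaE.
have xaC : `]x, a] `<=` C.
  apply: (interval_sub_component CE _ xaE Ca aa).
  exact: interval_is_interval.
have Cx : lbound C x.
  move=> y Cy; rewrite leNgt; apply/negP => yx; apply: Ex.
  by apply: (component_sub CE); apply: (component_is_interval CE Cy Ca);
    rewrite !ltW.
apply/eqP; rewrite eq_le lb_le_inf//=; last by exists a.
rewrite andbT leNgt; apply/negP => sx.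
(* The midpoint of [inf C] and [x] is in [`]x, a]], hence in [C]. *)
have le_as : inf C <= a by apply: ge_inf => //; exists x.
have /ge_inf -/(_ ((inf C + x) / 2)) : has_lbound C by exists x.
move=> /(_ (xaC _ _)); rewrite /= in_itv/= => H.
suff : inf C <= (inf C + x) / 2 by lra.
by apply: H; apply/andP; split; lra.
Qed.

End Components.

(** * Endpoints of the components of an enlargement *)

Section EnlargementComponents.
Variables (R : realType) (A : set R) (t : R).
Hypotheses (A_nonempty : A !=set0) (t_gt0 : 0 < t).

(** The distance is at least [t] because [sup C] is outside the enlargement.  It
    is at most [t] because points of [C], which are at distance less than [t]
    from [A], are found arbitrarily close to [sup C]. *)
Lemma sup_component_level C : components (enlargement A t) C ->
  has_ubound C -> level_set A t (sup C).
Proof.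
move=> CE Cub; have Eo := @open_enlargement R A t A_nonempty.
apply/eqP; rewrite /level_set/= eq_le.
have := sup_component_notin Eo CE Cub; rewrite /enlargement/= => /negP.
rewrite -leNgt => ->; rewrite andbT leNgt; apply/negP.
rewrite -subr_gt0 => e0.
have Csup : has_sup C by split=> //; exact: component_nonempty CE.
have [y Cy sy] := sup_adherent e0 Csup.
have ys : y <= sup C := sup_upper_bound Csup Cy.
have /(dist_to_ltP _ _ A_nonempty)[a Aa ya] := component_sub CE Cy.
have := dist_to_le (sup C) Aa.
have := ler_distD y (sup C) a; rewrite (@ger0_norm _ (sup C - y)) ?subr_ge0//.
lra.
Qed.

(** The nearest point of [A] to [x], which is [x - t] or [x + t], selects the
    component that has [x] as an endpoint. *)
Lemma level_setU : closed A ->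
  level_set A t `<=` sup @` components (enlargement A t) `|`
                     inf @` components (enlargement A t).
Proof.
move=> A_closed; set E := enlargement A t.
move=> x xt.
have Ex : ~ E x by rewrite /E/enlargement/= xt ltxx.
have EA a : A a -> components E (connected_component E a).
  move=> Aa; exists a => //.
  by apply/(dist_to_ltP _ _ A_nonempty); exists a; rewrite // subrr normr0.
have := dist_to_attained x A_nonempty A_closed.
rewrite xt => -[] Aa; [left|right].
  exists (connected_component E (x - t)); first exact: EA.
  apply: sup_componentE => //; first by rewrite gtrBl.
  move=> y; rewrite /= in_itv/= => /andP[ay yx].
  apply/(dist_to_ltP _ _ A_nonempty); exists (x - t) => //.
  by rewrite ger0_norm; lra.
exists (connected_component E (x + t)); first exact: EA.
apply: inf_componentE => //; first by rewrite ltrDl.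
move=> y; rewrite /= in_itv/= => /andP[ay yx].
apply/(dist_to_ltP _ _ A_nonempty); exists (x + t) => //.
by rewrite distrC ger0_norm; lra.
Qed.

End EnlargementComponents.

Theorem proposition1 (R : realType) (A : set R) (t : R)
    (A_nonempty : A !=set0) (A_closed : closed A) (t_gt0 : 0 < t) :
  (num_components R (enlargement A t) - 1 <= hausdorff0 (level_set A t))%E /\
  (hausdorff0 (level_set A t) <= 2%:E * num_components R (enlargement A t))%E.
Proof.
rewrite /num_components /hausdorff0; set E := enlargement A t; split.
  pose bounded := [set C | components E C /\ has_ubound C].
  pose unbounded := [set C | components E C /\ ~ has_ubound C].
  have coverK : components E `<=` bounded `|` unbounded.
    by move=> C CE; have [] := pselect (has_ubound C); [left|right].
  rewrite leeBlDr//.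
  apply: (le_trans (counting_card_le R (subset_card_le coverK))).
  apply: (le_trans (counting_setU R _ _)); apply: leeD.
    apply: counting_card_le.
    have Eo := @open_enlargement R A t A_nonempty.
    rewrite -(card_le_eql (inj_card_eq (sup_component_inj Eo))).
    apply: subset_card_le => _ [C [CE Cub] <-].
    exact: sup_component_level.
  (* [unbounded] has at most one element; the default [set0] is used only when
     it has none. *)
  rewrite -(counting_set1 R (xget set0 unbounded)).
  apply/counting_card_le/subset_card_le => C Cun.
  have [DE Dub] := xgetPex set0 (ex_intro unbounded C Cun).
  by case: Cun => CE Cub; exact: (unbounded_component_unique CE DE Cub Dub).
rewrite mule_natl mule2n.
have coverL := level_setU A_nonempty t_gt0 A_closed.
apply: (le_trans (counting_card_le R (subset_card_le coverL))).
apply: (le_trans (counting_setU R _ _)).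
by apply: leeD; apply/counting_card_le/card_image_le.
Qed.
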